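(* Let $\kappa\in\mathbb{Z}_{\ge0}^n$. The inclusion $\jmath_\kappa$ of the poset of $\kappa$-caged polymatroid rank functions on $[n]$ into the poset of all polymatroid rank functions on $[n]$ (both with the order $\preceq$) and the $\kappa$-retraction of rank functions $\mathrm{Ret}_\kappa$ form a Galois connection $\jmath_\kappa\dashv\mathrm{Ret}_\kappa$: for every $\kappa$-caged polymatroid rank function $g$ on $[n]$ and every polymatroid rank function $f$ on $[n]$, $$g\preceq f\iff g\preceq\mathrm{Ret}_\kappa(f).$$ Equivalently, for every polymatroid rank function $f$ on $[n]$, $\mathrm{Ret}_\kappa(f)$ is the greatest $\kappa$-caged polymatroid rank function $g$ on $[n]$ satisfying $g\preceq f$.
   Context: Let $[n]=\{1,\dots,n\}$. A polymatroid rank function on $[n]$ is a function $f\colon 2^{[n]}\to\mathbb{Z}_{\ge0}$ with $f(\varnothing)=0$, $f(S)\le f(T)$ whenever $S\subseteq T$, and $f(S\cup T)+f(S\cap T)\le f(S)+f(T)$ for all $S,T$. For $\kappa\in\mathbb{Z}_{\ge0}^n$ and $S\subseteq[n]$ put $\kappa(S)=\sum_{i\in S}\kappa_i$. A rank function $f$ is $\kappa$-caged if $f(S)\le\kappa(S)$ for all $S\subseteq[n]$ (equivalently $f(\{i\})\le\kappa_i$ for all $i$). The weak-map order: $f_2\preceq f_1$ means $f_2(A)\le f_1(A)$ for every $A\subseteq[n]$. The $\kappa$-retraction of $f$ is $\mathrm{Ret}_\kappa(f)(X)=\min_{Y\subseteq X}\big(f(Y)+\kappa(X\setminus Y)\big)$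 for $X\subseteq[n]$; it is a $\kappa$-caged polymatroid rank function. Maps $L\colon P\to Q$, $R\colon Q\to P$ of posets form a Galois connection $L\dashv R$ if $L(p)\le q\iff p\le R(q)$ for all $p\in P$, $q\in Q$. *)

(* Defs.v *)
From HB Require Import structures.
From mathcomp Require Import all_boot all_order.

Set Implicit Arguments.
Unset Strict Implicit.
Unset Printing Implicit Defensive.

Import Order.TTheory.

Local Open Scope nat_scope.

(* The ground set is 'I_n = {0, ..., n - 1} instead of {1, ..., n}, and values
   in Z_{>= 0} are natural numbers. *)
Notation set_function n := {ffun {set 'I_n} -> nat}.

Definition is_rank_function n (f : set_function n) : bool :=
  [&& f set0 == 0,
      [forall S : {set 'I_n}, forall T : {set 'I_n}, (S \subset T) ==> (f S <= f T)]
    & [forall S : {set 'I_n}, forall T : {set 'I_n},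
         f (S :|: T) + f (S :&: T) <= f S + f T]].

Definition weight n (kappa : 'I_n -> nat) (S : {set 'I_n}) : nat :=
  \sum_(i in S) kappa i.

Definition is_caged n (kappa : 'I_n -> nat) (f : set_function n) : bool :=
  [forall S : {set 'I_n}, f S <= weight kappa S].

Record rank_function n := RankFunction {
  rank_val :> set_function n;
  rank_valP : is_rank_function rank_val }.

HB.instance Definition _ n := [isSub for @rank_val n].
HB.instance Definition _ n := [Choice of rank_function n by <:].

Record caged_rank_function n (kappa : 'I_n -> nat) := CagedRankFunction {
  caged_val : rank_function n;
  caged_valP : is_caged kappa caged_val }.

HB.instance Definition _ n (kappa : 'I_n -> nat) := [isSub for @caged_val n kappa].
HB.instance Definition _ n (kappa : 'I_n -> nat) :=
  [Choice of caged_rank_function kappa by <:].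

Definition caged_incl n (kappa : 'I_n -> nat) (g : caged_rank_function kappa) :
  rank_function n := caged_val g.

Definition weak_le n (f2 f1 : rank_function n) : bool :=
  [forall A : {set 'I_n}, f2 A <= f1 A].

Lemma weak_le_refl n : reflexive (@weak_le n).
Proof. by move=> f; apply/forallP=> A. Qed.

Lemma weak_le_anti n : antisymmetric (@weak_le n).
Proof.
move=> f g /andP[/forallP fg /forallP gf]; apply/val_inj/ffunP=> A.
by apply/eqP; rewrite eqn_leq fg gf.
Qed.

Lemma weak_le_trans n : transitive (@weak_le n).
Proof.
move=> g f h /forallP fg /forallP gh; apply/forallP=> A.
exact: leq_trans (fg A) (gh A).
Qed.

Fact weak_map_display : Order.disp_t. Proof. exact: Order.Disp tt tt. Qed.

HB.instance Definition _ n :=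
  Order.Le_isPOrder.Build weak_map_display (rank_function n)
    (@weak_le_refl n) (@weak_le_anti n) (@weak_le_trans n).
HB.instance Definition _ n (kappa : 'I_n -> nat) :=
  [SubChoice_isSubPOrder of caged_rank_function kappa by <: with weak_map_display].

Definition retraction_term n (kappa : 'I_n -> nat) (f : set_function n)
    (X Y : {set 'I_n}) : nat :=
  f Y + weight kappa (X :\: Y).

(* A minimum over a nonempty family: the initial value is the term Y = set0. *)
Definition retraction_fun n (kappa : 'I_n -> nat) (f : set_function n) :
    set_function n :=
  [ffun X : {set 'I_n} =>
     \big[minn/retraction_term kappa f X set0]_(Y : {set 'I_n} | Y \subset X)
       retraction_term kappa f X Y].

Section RetractionIsCaged.
Variables (n : nat) (kappa : 'I_n -> nat).

Lemma retraction_fun_le (f : set_function n) (X Y : {set 'I_n}) :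
  Y \subset X -> retraction_fun kappa f X <= retraction_term kappa f X Y.
Proof.
move=> YX; rewrite ffunE.
elim: (index_enum _) (mem_index_enum Y) => // Z r IHr; rewrite inE big_cons.
case/predU1P=> [<-|/IHr le_r]; first by rewrite YX geq_minl.
by case: ifP => // _; rewrite geq_min le_r orbT.
Qed.

Lemma retraction_fun_attained (f : set_function n) (X : {set 'I_n}) :
  exists2 Y : {set 'I_n},
    Y \subset X & retraction_fun kappa f X = retraction_term kappa f X Y.
Proof.
rewrite ffunE; elim/big_ind: _ => [|_ _ [Y YX ->] [Z ZX ->]|Y YX].
- by exists set0; rewrite ?sub0set.
- by rewrite /minn; case: ifP => _; [exists Y | exists Z].
- by exists Y.
Qed.

Lemma weightS (A B : {set 'I_n}) :
  A \subset B -> weight kappa A <= weight kappa B.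
Proof.
move=> AB; rewrite /weight [leqRHS](big_setID A) /= (setIidPr AB).
exact: leq_addr.
Qed.

Lemma weight_indic (A : {set 'I_n}) :
  weight kappa A = \sum_i (i \in A) * kappa i.
Proof.
by rewrite /weight big_mkcond; apply: eq_bigr => i _; case: ifP; rewrite ?mul1n.
Qed.

Lemma weight_modular (X X' Y Y' : {set 'I_n}) :
  Y \subset X -> Y' \subset X' ->
  weight kappa ((X :|: X') :\: (Y :|: Y')) + weight kappa ((X :&: X') :\: (Y :&: Y'))
    = weight kappa (X :\: Y) + weight kappa (X' :\: Y').
Proof.
move=> /subsetP YX /subsetP YX'; rewrite !weight_indic -!big_split /=.
apply: eq_bigr => i _; rewrite -!mulnDl; congr (_ * _); rewrite !inE.
move: (YX i) (YX' i).
by do 4!case: (i \in _) => //; move=> // h h'; try (by have := h isT); try (by have := h' isT).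
Qed.

Lemma retraction_fun_rank (f : rank_function n) :
  is_rank_function (retraction_fun kappa f).
Proof.
have /and3P[/eqP f0 /forallP fmon /forallP fsub] := rank_valP f.
apply/and3P; split.
- rewrite -leqn0 (leq_trans (retraction_fun_le _ (sub0set _))) //.
  by rewrite /retraction_term f0 setD0 /weight big_set0.
- apply/forallP=> X; apply/forallP=> X'; apply/implyP=> XX'.
  have [Y YX' ->] := retraction_fun_attained f X'.
  apply: leq_trans (retraction_fun_le _ (subsetIr Y X)) _.
  apply: leq_add.
    by have /forallP/(_ Y)/implyP := fmon (Y :&: X); apply; apply: subsetIl.
  by apply: weightS; rewrite setDIr setDv setU0 setSD.
- apply/forallP=> X; apply/forallP=> X'.
  have [Y YX ->] := retraction_fun_attained f X.
  have [Y' YX' ->] := retraction_fun_attained f X'.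
  apply: leq_trans (leq_add (retraction_fun_le _ (setUSS YX YX'))
                            (retraction_fun_le _ (setISS YX YX'))) _.
  rewrite /retraction_term addnACA weight_modular // [leqRHS]addnACA leq_add2r.
  by have /forallP/(_ Y') := fsub Y.
Qed.

Lemma retraction_fun_caged (f : rank_function n) :
  is_caged kappa (retraction_fun kappa f).
Proof.
have /and3P[/eqP f0 _ _] := rank_valP f.
apply/forallP=> X; apply: leq_trans (retraction_fun_le _ (sub0set X)) _.
by rewrite /retraction_term f0 setD0.
Qed.

End RetractionIsCaged.

Definition retraction n (kappa : 'I_n -> nat) (f : rank_function n) :
    caged_rank_function kappa :=
  @CagedRankFunction n kappa (RankFunction (retraction_fun_rank kappa f))
    (retraction_fun_caged kappa f).

Definition galois_connection d d' (P : porderType d) (Q : porderType d')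
    (L : P -> Q) (R : Q -> P) : Prop :=
  forall (p : P) (q : Q), (L p <= q)%O <-> (p <= R q)%O.

(* Main.v *)
Require Import Defs.
From mathcomp Require Import all_boot all_order.

(** The retraction takes a minimum over the ways of splitting [X] into a part
    [Y] that is measured by [f] and a rest [X :\: Y] that is measured by
    [kappa].  The splitting [Y = X] is allowed, so the retraction lies below
    [f] ([retraction_le]).  Conversely, a caged rank function [g] below [f] is
    subadditive, so every splitting bounds it:
    [g X <= g Y + g (X :\: Y) <= f Y + kappa (X :\: Y)], the first summand by
    [g <= f] and the second by the cage.  Hence [g] lies below the minimum
    ([le_retraction]).  The Galois connection is these two facts put together
    with transitivity. *)

Import Order.TTheory.

(** Submodularity applied to the disjoint sets [Y] and [X :\: Y]; the term of
    their intersection is nonnegative and is dropped. *)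
Lemma rank_subadditive n (f : rank_function n) (X Y : {set 'I_n}) :
  Y \subset X -> f X <= f Y + f (X :\: Y).
Proof.
move=> YX; have /and3P[_ _ /forallP/(_ Y)/forallP/(_ (X :\: Y))] := rank_valP f.
rewrite -{1}(setIidPr YX) setID.
exact: leq_trans (leq_addr _ _).
Qed.

Lemma retraction_le n (kappa : 'I_n -> nat) (f : rank_function n) :
  (caged_incl (retraction kappa f) <= f)%O.
Proof.
apply/forallP=> X; apply: leq_trans (retraction_fun_le _ _ (subxx X)) _.
by rewrite /retraction_term setDv /weight big_set0 addn0.
Qed.

Lemma le_retraction n (kappa : 'I_n -> nat) (f : rank_function n)
    (g : caged_rank_function kappa) :
  (caged_incl g <= f)%O -> (g <= retraction kappa f)%O.
Proof.
move=> /forallP gf; apply/forallP=> X /=.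
have [Y YX ->] := retraction_fun_attained kappa f X.
apply: leq_trans (rank_subadditive _ _ _ _ YX) (leq_add (gf Y) _).
exact: (forallP (caged_valP g)).
Qed.

Theorem theorem4p9 (n : nat) (kappa : 'I_n -> nat) :
  galois_connection (@caged_incl n kappa) (@retraction n kappa) /\
  (forall f : rank_function n,
     (caged_incl (retraction kappa f) <= f)%O /\
     (forall g : caged_rank_function kappa,
        (caged_incl g <= f)%O -> (g <= retraction kappa f)%O)).
Proof.
split=> [g f|f]; last by split; [apply: retraction_le|apply: le_retraction].
split; first exact: le_retraction.
(* The order on caged functions is the one induced by the inclusion. *)
by move=> gRf; apply: le_trans (retraction_le _ kappa f).
Qed.
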